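(* Let $\Bbbk$ be a field. Consider the sequence $(b_n)_{n\ge1}$ defined by $b_2=1$ and $b_n=0$ for $n\ne 2$. Then, for every $q\in\Bbbk$, there is no finite-dimensional connected $q$-bimonoid $\mathbf{h}$ for which $$1-\frac{1}{\mathsf{O}_{\mathbf{h}}(x)}=\sum_{n\ge1}b_nx^n ,$$ where $\mathsf{O}_{\mathbf{h}}(x)=\sum_{n\ge 0}\dim_\Bbbk\mathbf{h}[n]\,x^n$ is the ordinary generating function of $\mathbf{h}$.
   Context: **Species.** Fix a field $\Bbbk$. A species is a functor from the category of finite sets and bijections to the category of $\Bbbk$-vector spaces; morphisms are natural transformations. $\mathbf{p}[n]$ denotes $\mathbf{p}[\{1,\dots,n\}]$. A species $\mathbf{p}$ is finite-dimensional if each $\mathbf{p}[n]$, $n\ge0$, is finite-dimensional, and connected if $\dim_\Bbbk\mathbf{p}[\emptyset]=1$. $I=S\sqcup T$ means $I=S\cup T$ and $S\cap T=\emptyset$ (ordered pair, parts possibly empty). **Monoids and comonoids.** A monoid (in species) is a species $\mathbf{p}$ with linear maps $\mu_{S,T}:\mathbf{p}[S]\otimes\mathbf{p}[T]\to\mathbf{p}[I]$, one for each $I=S\sqcup T$, natural with respect to bijections of $I$, and a linear map $\iota_\emptyset:\Bbbk\to\mathbf{p}[\emptyset]$, which are associative ($\mu_{R\sqcup S,T}(\mu_{R,S}\otimes\mathrm{id})=\mu_{R,S\sqcup T}(\mathrm{id}\otimes\mu_{S,T})$) and unital ($\mu_{\emptyset,I}(\iota_\emptyset\otimes\mathrm{id})=\mathrm{id}=\mu_{I,\emptyset}(\mathrm{id}\otimes\iota_\emptyset)$).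 Dually, a comonoid has natural maps $\Delta_{S,T}:\mathbf{p}[I]\to\mathbf{p}[S]\otimes\mathbf{p}[T]$ and $\epsilon_\emptyset:\mathbf{p}[\emptyset]\to\Bbbk$, coassociative and counital. **$q$-bimonoids.** For $q\in\Bbbk$ (possibly zero), a $q$-bimonoid is a species $\mathbf{h}$ which is a monoid and a comonoid such that (i) for any $I=S\sqcup T=S'\sqcup T'$, with $A=S\cap S'$, $B=S\cap T'$, $C=T\cap S'$, $D=T\cap T'$, $$\Delta_{S',T'}\,\mu_{S,T}=(\mu_{A,C}\otimes\mu_{B,D})(\mathrm{id}\otimes\beta_q\otimes\mathrm{id})(\Delta_{A,B}\otimes\Delta_{C,D}),$$ where $\beta_q:\mathbf{h}[B]\otimes\mathbf{h}[C]\to\mathbf{h}[C]\otimes\mathbf{h}[B]$ is $x\otimes y\mapsto q^{|B||C|}\,y\otimes x$ (with $0^0=1$); and (ii) $\epsilon_\emptyset\iota_\emptyset=\mathrm{id}$, $\epsilon_\emptyset\mu_{\emptyset,\emptyset}=\epsilon_\emptyset\otimes\epsilon_\emptyset$, $\Delta_{\emptyset,\emptyset}\iota_\emptyset=\iota_\emptyset\otimes\iota_\emptyset$. *)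

(* Defs.v *)
From HB Require Import structures.
From mathcomp Require Import all_boot all_order all_algebra.

Set Implicit Arguments.
Unset Strict Implicit.
Unset Printing Implicit Defensive.

Import GRing.Theory.
Local Open Scope ring_scope.

(* Tensor products of finite-dimensional vector spaces. U (x) V is realized    *)
(* as the space of (dim U) x (dim V) matrices, the pure tensor u (x) v being   *)
(* the rank one matrix of products of coordinates. The lemmas tpure_linear_l,  *)
(* tpure_linear_r, tliftE and tens_ext are the universal property; nothing     *)
(* depends on the matrix encoding beyond them.                                 *)

Section Tensor.
Variable k : fieldType.
Implicit Types U V W : vectType k.

Definition tens U V : vectType k := 'M[k]_(\dim {:U}, \dim {:V}).

Definition tpure U V (u : U) (v : V) : tens U V :=
  \matrix_(i, j) (coord (vbasis {:U}) i u * coord (vbasis {:V}) j v).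

Lemma tpure_linear_l U V (v : V) : linear (fun u : U => tpure u v).
Proof.
by move=> a u u'; apply/matrixP=> i j; rewrite !mxE linearP mulrDl mulrA.
Qed.

Lemma tpure_linear_r U V (u : U) : linear (fun v : V => tpure u v).
Proof.
by move=> a v v'; apply/matrixP=> i j; rewrite !mxE linearP mulrDr mulrCA.
Qed.

Definition bilin U V W (phi : U -> V -> W) : Prop :=
  (forall v, linear (fun u => phi u v)) /\ (forall u, linear (phi u)).

Section Lift.
Variables (U V W : vectType k) (phi : U -> V -> W).

Definition tlift_fun (t : tens U V) : W :=
  \sum_(i < \dim {:U}) \sum_(j < \dim {:V})
    t i j *: phi (vbasis {:U})`_i (vbasis {:V})`_j.

Fact tlift_fun_is_linear : linear tlift_fun.
Proof.
move=> a s t; rewrite /tlift_fun scaler_sumr -big_split; apply: eq_bigr => i _.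
rewrite scaler_sumr -big_split; apply: eq_bigr => j _ /=.
by rewrite !mxE scalerDl scalerA.
Qed.

HB.instance Definition _ :=
  GRing.isLinear.Build k (tens U V) W _ tlift_fun tlift_fun_is_linear.

(* The linear map on U (x) V induced by phi; only meaningful for bilinear phi. *)
Definition tlift : 'Hom(tens U V, W) := linfun tlift_fun.

Lemma tliftE : bilin phi -> forall u v, tlift (tpure u v) = phi u v.
Proof.
move=> [phil phir] u v; rewrite lfunE /= /tlift_fun.
pose fl w : {linear U -> W} := HB.pack (fun x => phi x w)
  (GRing.isLinear.Build k U W _ (fun x => phi x w) (phil w)).
pose fr w : {linear V -> W} := HB.pack (phi w)
  (GRing.isLinear.Build k V W _ (phi w) (phir w)).
have eU := coord_vbasis (memvf u); have eV := coord_vbasis (memvf v).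
rewrite {2}eU -[RHS]/(fl v _) linear_sum; apply: eq_bigr => i _.
rewrite linearZ /= {2}eV -[phi _ _]/(fr _ _) linear_sum scaler_sumr.
apply: eq_bigr => j _; rewrite linearZ scalerA; congr (_ *: _).
by rewrite mxE.
Qed.

End Lift.

Lemma tens_ext U V W (f g : 'Hom(tens U V, W)) :
  (forall u v, f (tpure u v) = g (tpure u v)) -> f = g.
Proof.
move=> fg; apply/lfunP => t; rewrite [t]matrix_sum_delta !linear_sum /=.
apply: eq_bigr => i _; rewrite !linear_sum; apply: eq_bigr => j _.
rewrite !linearZ; congr (_ *: _).
suff <- : tpure (vbasis {:U})`_i (vbasis {:V})`_j = delta_mx i j by apply: fg.
apply/matrixP=> i' j'.
rewrite !mxE !coord_free ?(basis_free (vbasisP _)) //.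
by rewrite -natrM mulnb !(eq_sym i', eq_sym j').
Qed.

Definition tmap U V U' V' (f : 'Hom(U, U')) (g : 'Hom(V, V')) :
    'Hom(tens U V, tens U' V') :=
  tlift (fun u v => tpure (f u) (g v)).

Definition tassoc U V W : 'Hom(tens (tens U V) W, tens U (tens V W)) :=
  tlift (fun s w => tlift (fun u v => tpure u (tpure v w)) s).

Definition tunitl V : 'Hom(tens k^o V, V) := tlift (fun (a : k^o) v => a *: v).

Definition tunitr V : 'Hom(tens V k^o, V) := tlift (fun v (a : k^o) => a *: v).

(* id (x) beta (x) id with beta (b (x) c) = r *: (c (x) b), in the bracketing  *)
(* (a (x) b) (x) (c (x) d) |-> r *: ((a (x) c) (x) (b (x) d)).                 *)
Definition tswap U V U' V' (r : k) :
    'Hom(tens (tens U V) (tens U' V'), tens (tens U U') (tens V V')) :=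
  tlift (fun s t =>
    tlift (fun a b =>
      tlift (fun c d => r *: tpure (tpure a c) (tpure b d)) t) s).

Lemma tmapE U V U' V' (f : 'Hom(U, U')) (g : 'Hom(V, V')) u v :
  tmap f g (tpure u v) = tpure (f u) (g v).
Proof.
rewrite tliftE //; split=> [w|w] a x y.
  by rewrite linearP tpure_linear_l.
by rewrite linearP tpure_linear_r.
Qed.

Lemma tunitlE V (a : k^o) (v : V) : tunitl V (tpure a v) = a *: v.
Proof.
rewrite tliftE //; split=> [w|w] b x y; first by rewrite scalerDl -scalerA.
by rewrite scalerDr !scalerA mulrC.
Qed.

Lemma tunitrE V (a : k^o) (v : V) : tunitr V (tpure v a) = a *: v.
Proof.
rewrite tliftE //; split=> [w|w] b x y; last by rewrite scalerDl -scalerA.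
by rewrite scalerDr !scalerA mulrC.
Qed.

(* Linearity of a lift in the bilinear map it is built from. *)
Lemma tliftP U V W (a : k) (phi psi chi : U -> V -> W) t :
    (forall u v, chi u v = a *: phi u v + psi u v) ->
  tlift chi t = a *: tlift phi t + tlift psi t.
Proof.
move=> e; rewrite !lfunE /= /tlift_fun scaler_sumr -big_split.
apply: eq_bigr => i _; rewrite scaler_sumr -big_split; apply: eq_bigr => j _ /=.
by rewrite e scalerDr !scalerA mulrC.
Qed.

Lemma tassocE U V W (u : U) (v : V) (w : W) :
  tassoc U V W (tpure (tpure u v) w) = tpure u (tpure v w).
Proof.
rewrite /tassoc !tliftE //.
- split=> [w'|u'] a x y; first by rewrite tpure_linear_l.
  by rewrite tpure_linear_l tpure_linear_r.
split=> [w'|s] a x y; first by rewrite linearP.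
by apply: tliftP => u' v'; rewrite !tpure_linear_r.
Qed.

Lemma tswapE U V U' V' (r : k) (a : U) (b : V) (c : U') (d : V') :
  tswap U V U' V' r (tpure (tpure a b) (tpure c d)) =
  r *: tpure (tpure a c) (tpure b d).
Proof.
have scD (T : vectType k) (x : k) (s t : T) :
  r *: (x *: s + t) = x *: (r *: s) + r *: t.
  by rewrite scalerDr !scalerA mulrC.
have b1 a' b' : bilin (fun (c : U') (d : V') =>
    r *: tpure (tpure (a' : U) c) (tpure (b' : V) d)).
  split=> [y|y] x s t; last by rewrite !tpure_linear_r scD.
  by rewrite tpure_linear_r tpure_linear_l scD.
rewrite /tswap !tliftE //.
- split=> [b'|a'] x s t; apply: tliftP => c' d'.
    by rewrite !tpure_linear_l scD.
  by rewrite tpure_linear_l tpure_linear_r scD.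
split=> [t'|s'] x s t; first by rewrite linearP.
by apply: tliftP => a' b'; rewrite linearP.
Qed.

End Tensor.

Record bij (S T : finType) := Bij {
  bij_fun :> S -> T;
  bijP : bijective bij_fun
}.

Definition id_bij (S : finType) : bij S S := @Bij S S id (inv_bij (fun=> erefl)).

Definition comp_bij (R S T : finType) (f : bij S T) (g : bij R S) : bij R T :=
  Bij (bij_comp (bijP f) (bijP g)).

(* Decompositions I = S |_| T of a finite set into an ordered pair of          *)
(* disjoint, possibly empty, parts. A part is a finite set with its inclusion  *)
(* into I, so that a set, its subsets, and the subsets of those are all        *)
(* objects of the same category.                                               *)
Record decomp (I S T : finType) := Decomp {
  incl : S -> I;
  incr : T -> I;
  incl_inj : injective incl;
  incr_inj : injective incr;
  inc_cover : forall i, (i \in codom incl) || (i \in codom incr);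
  inc_disjoint : [disjoint codom incl & codom incr]
}.

(* The bijection h : I -> I' restricts to f : S -> S' and g : T -> T'. *)
Definition decomp_bij (I S T I' S' T' : finType)
    (d : decomp I S T) (d' : decomp I' S' T')
    (h : bij I I') (f : bij S S') (g : bij T T') : Prop :=
  (forall s, h (incl d s) = incl d' (f s)) /\
  (forall t, h (incr d t) = incr d' (g t)).

(* I = (R |_| S) |_| T = R |_| (S |_| T), where RS = R |_| S, ST = S |_| T and *)
(* each of R, S, T has the same inclusion into I both ways.                    *)
Definition decomp3 (I RS ST R S T : finType)
    (dRS : decomp RS R S) (dRS_T : decomp I RS T)
    (dST : decomp ST S T) (dR_ST : decomp I R ST) : Prop :=
  [/\ forall r, incl dRS_T (incl dRS r) = incl dR_ST r,
      forall s, incl dRS_T (incr dRS s) = incr dR_ST (incl dST s)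
    & forall t, incr dRS_T t = incr dR_ST (incr dST t)].

(* I = S |_| T = S' |_| T' with S = A |_| B, T = C |_| D, S' = A |_| C and     *)
(* T' = B |_| D compatibly with the inclusions into I. This forces             *)
(* A = S :&: S', B = S :&: T', C = T :&: S' and D = T :&: T' inside I.         *)
Definition decomp4 (I S T S' T' A B C D : finType)
    (dI : decomp I S T) (dI' : decomp I S' T')
    (dS : decomp S A B) (dT : decomp T C D)
    (dS' : decomp S' A C) (dT' : decomp T' B D) : Prop :=
  [/\ forall a, incl dI (incl dS a) = incl dI' (incl dS' a),
      forall b, incl dI (incr dS b) = incr dI' (incl dT' b),
      forall c, incr dI (incl dT c) = incl dI' (incr dS' c)
    & forall d, incr dI (incr dT d) = incr dI' (incr dT' d)].

(* Finite-dimensional species: the values are vectTypes. Since every finite    *)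
(* set is in bijection with some 'I_n, it is the same to ask for finite        *)
(* dimension on the sets 'I_n only. The law sp_ext says that bijections are    *)
(* compared pointwise.                                                         *)
Record species (k : fieldType) := Species {
  sp_obj :> finType -> vectType k;
  sp_map : forall S T : finType, bij S T -> 'Hom(sp_obj S, sp_obj T);
  sp_ext : forall (S T : finType) (f g : bij S T),
    f =1 g -> sp_map f = sp_map g;
  sp_id : forall S : finType, sp_map (id_bij S) = \1%VF;
  sp_comp : forall (R S T : finType) (f : bij S T) (g : bij R S),
    sp_map (comp_bij f g) = (sp_map f \o sp_map g)%VF
}.

Record sp_monoid (k : fieldType) (p : species k) := SpMonoid {
  mu : forall I S T : finType, decomp I S T -> 'Hom(tens (p S) (p T), p I);
  iota0 : 'Hom(k^o, p void);
  mu_natural : forall (I S T I' S' T' : finType)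
      (d : decomp I S T) (d' : decomp I' S' T')
      (h : bij I I') (f : bij S S') (g : bij T T'),
    decomp_bij d d' h f g ->
    (sp_map p h \o mu d = mu d' \o tmap (sp_map p f) (sp_map p g))%VF;
  mu_assoc : forall (I RS ST R S T : finType)
      (dRS : decomp RS R S) (dRS_T : decomp I RS T)
      (dST : decomp ST S T) (dR_ST : decomp I R ST),
    decomp3 dRS dRS_T dST dR_ST ->
    (mu dRS_T \o tmap (mu dRS) \1 =
     mu dR_ST \o tmap \1 (mu dST) \o tassoc (p R) (p S) (p T))%VF;
  mu_unitl : forall (I : finType) (d : decomp I void I),
    incr d =1 id -> (mu d \o tmap iota0 \1 = tunitl (p I))%VF;
  mu_unitr : forall (I : finType) (d : decomp I I void),
    incl d =1 id -> (mu d \o tmap \1 iota0 = tunitr (p I))%VF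
}.

Record sp_comonoid (k : fieldType) (p : species k) := SpComonoid {
  Delta : forall I S T : finType, decomp I S T -> 'Hom(p I, tens (p S) (p T));
  eps0 : 'Hom(p void, k^o);
  Delta_natural : forall (I S T I' S' T' : finType)
      (d : decomp I S T) (d' : decomp I' S' T')
      (h : bij I I') (f : bij S S') (g : bij T T'),
    decomp_bij d d' h f g ->
    (Delta d' \o sp_map p h = tmap (sp_map p f) (sp_map p g) \o Delta d)%VF;
  Delta_coassoc : forall (I RS ST R S T : finType)
      (dRS : decomp RS R S) (dRS_T : decomp I RS T)
      (dST : decomp ST S T) (dR_ST : decomp I R ST),
    decomp3 dRS dRS_T dST dR_ST ->
    (tassoc (p R) (p S) (p T) \o (tmap (Delta dRS) \1 \o Delta dRS_T) =
     tmap \1 (Delta dST) \o Delta dR_ST)%VF;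
  Delta_counitl : forall (I : finType) (d : decomp I void I),
    incr d =1 id -> (tunitl (p I) \o (tmap eps0 \1 \o Delta d) = \1)%VF;
  Delta_counitr : forall (I : finType) (d : decomp I I void),
    incl d =1 id -> (tunitr (p I) \o (tmap \1 eps0 \o Delta d) = \1)%VF
}.

(* In eps0_mu and Delta_iota0, tunitl k^o : k (x) k -> k is the canonical      *)
(* isomorphism.                                                                *)
Record qbimonoid (k : fieldType) (q : k) := QBimonoid {
  qb_species :> species k;
  qb_monoid : sp_monoid qb_species;
  qb_comonoid : sp_comonoid qb_species;
  Delta_mu : forall (I S T S' T' A B C D : finType)
      (dI : decomp I S T) (dI' : decomp I S' T')
      (dS : decomp S A B) (dT : decomp T C D)
      (dS' : decomp S' A C) (dT' : decomp T' B D),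
    decomp4 dI dI' dS dT dS' dT' ->
    (Delta qb_comonoid dI' \o mu qb_monoid dI =
     tmap (mu qb_monoid dS') (mu qb_monoid dT') \o
     (tswap (qb_species A) (qb_species B) (qb_species C) (qb_species D)
        (q ^+ (#|B| * #|C|)) \o
      tmap (Delta qb_comonoid dS) (Delta qb_comonoid dT)))%VF;
  eps0_iota0 : (eps0 qb_comonoid \o iota0 qb_monoid = \1)%VF;
  eps0_mu : forall d : decomp void void void,
    (eps0 qb_comonoid \o mu qb_monoid d =
     tunitl k^o \o tmap (eps0 qb_comonoid) (eps0 qb_comonoid))%VF;
  Delta_iota0 : forall d : decomp void void void,
    (Delta qb_comonoid d \o iota0 qb_monoid \o tunitl k^o =
     tmap (iota0 qb_monoid) (iota0 qb_monoid))%VF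
}.

Definition connected (k : fieldType) (p : species k) : Prop :=
  \dim {: p void} = 1%N.

(* Formal power series over a field, as coefficient sequences. *)

Section PowerSeries.
Variable F : fieldType.
Implicit Types a b : nat -> F.

Definition ps_one : nat -> F := fun n => (n == 0)%N%:R.

Definition ps_sub a b : nat -> F := fun n => a n - b n.

Definition ps_mul a b : nat -> F := fun n => \sum_(i < n.+1) a i * b (n - i)%N.

(* The first n coefficients of 1 / a, from a_0 g_n = [n = 0] -                 *)
(* sum_(i < n) a_(n - i) g_i.                                                  *)
Fixpoint ps_inv_seq a (n : nat) : seq F :=
  if n is m.+1 then
    let s := ps_inv_seq a m in
    rcons s (((m == 0)%N%:R - \sum_(i < m) a (m - i)%N * s`_i) / a 0%N)
  else [::].

(* The inverse 1 / a, for a with nonzero constant term; see ps_mulV. *)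
Definition ps_inv a : nat -> F := fun n => (ps_inv_seq a n.+1)`_n.

Lemma size_ps_inv_seq a n : size (ps_inv_seq a n) = n.
Proof. by elim: n => //= n IHn; rewrite size_rcons IHn. Qed.

Lemma nth_ps_inv_seq a n i : (i < n)%N -> (ps_inv_seq a n)`_i = ps_inv a i.
Proof.
elim: n => // n IHn; rewrite ltnS leq_eqVlt => /predU1P[->//|lt_in].
by rewrite /= nth_rcons size_ps_inv_seq lt_in IHn.
Qed.

Lemma ps_mulV a : a 0%N != 0 -> ps_mul a (ps_inv a) =1 ps_one.
Proof.
move=> a0 n; rewrite /ps_mul (reindex_inj rev_ord_inj) /= big_ord_recr /=.
rewrite !subSS subnn subn0 [ps_inv a n]/ps_inv /= nth_rcons size_ps_inv_seq.
rewrite ltnn eqxx mulrCA divff // mulr1 addrC.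
rewrite [X in _ + X](_ : _ = \sum_(i < n) a (n - i)%N * (ps_inv_seq a n)`_i).
  by rewrite subrK.
by apply: eq_bigr => i _; rewrite subSS subKn ?nth_ps_inv_seq // ltnW.
Qed.

End PowerSeries.

(* The ordinary generating function; 'I_n stands for {1, ..., n}, and the      *)
(* dimensions are taken in rat, not in k.                                      *)
Definition ogf (k : fieldType) (p : species k) : nat -> rat :=
  fun n => (\dim {: p 'I_n})%:R.

(* Main.v *)
Require Import Defs.
From mathcomp Require Import all_boot all_order all_algebra.
From mathcomp Require Import fingroup perm.

(** The equation forces the ordinary generating function to be
    [1 / (1 - x^2)], so that [dim h[n]] is 1 for [n] even and 0 for [n] odd
    (ps_inv_1subX2 reads off the degrees 1, 2 and 4).

    In a connected q-bimonoid the compatibility axiom, taken with the same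
    decomposition [I = S + T] on both sides, has [B] and [C] empty; the power
    of [q] is 1 and every coproduct in it splits off an empty set, so it says
    that [Delta_{S,T} mu_{S,T} = id] (Delta_mu_same). Take [I = {0,1,2,3}] and
    [S = {0,1}], [T = {2,3}]. As [h[S] (x) h[T]] and [h[I]] both have
    dimension 1, [mu_{S,T}] is an isomorphism with inverse [Delta_{S,T}].

    Now take [S' = {0,2}], [T' = {1,3}]. The four intersections are singletons,
    where [h] vanishes, and [Delta_{S',T'} mu_{S,T}] factors through a tensor
    product of their values, so it is 0 (Delta_mu_crossing). As [mu_{S,T}] is
    onto, [Delta_{S',T'} = 0]. But [Delta_{S',T'} mu_{S',T'}] is the identity
    of a space of dimension 1, a contradiction (dim_crossing).

    The argument is uniform in [q]: the coefficient [q^(|B||C|)] has exponent 0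
    in the first use of compatibility and multiplies 0 in the second. *)

Set Implicit Arguments.
Unset Strict Implicit.
Unset Printing Implicit Defensive.

Import GRing.Theory Num.Theory.
Local Open Scope ring_scope.

(** * Linear maps and tensor products *)

Lemma comp_lfun_id_sym (k : fieldType) (U V : vectType k)
    (f : 'Hom(U, V)) (g : 'Hom(V, U)) :
  \dim {:U} = \dim {:V} -> (g \o f = \1)%VF -> (f \o g = \1)%VF.
Proof.
move=> dimUV gf.
have fK : cancel f g by move=> u; rewrite -comp_lfunE gf id_lfunE.
have f_inj : lker f == 0%VS by apply/lker0P; exact: can_inj fK.
have f_surj : limg f = fullv.
  apply/eqP; rewrite eqEdim subvf /=.
  by rewrite limg_dim_eq ?dimUV // (eqP f_inj) capv0.
apply/lfunP => v; rewrite comp_lfunE id_lfunE.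
have /memv_imgP[u _ ->] : v \in limg f by rewrite f_surj memvf.
by rewrite fK.
Qed.

Lemma dim_tens (k : fieldType) (U V : vectType k) :
  \dim {: tens U V} = (\dim {:U} * \dim {:V})%N.
Proof. by rewrite dimvf. Qed.

Lemma dim_ground (k : fieldType) : \dim {: k^o} = 1%N.
Proof. by rewrite dimvf. Qed.

Lemma dim0_lfun (k : fieldType) (U V : vectType k) (f : 'Hom(U, V)) :
  \dim {:V} = 0%N -> f = 0.
Proof.
move=> V0; apply/lfunP => u; rewrite zero_lfunE; apply/eqP.
by rewrite -memv0; move/eqP: V0; rewrite dimv_eq0 => /eqP <-; exact: memvf.
Qed.

Lemma tmap_comp (k : fieldType) (U U' U'' V V' V'' : vectType k)
    (f : 'Hom(U, U')) (f' : 'Hom(U', U''))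
    (g : 'Hom(V, V')) (g' : 'Hom(V', V'')) :
  (tmap f' g' \o tmap f g = tmap (f' \o f) (g' \o g))%VF.
Proof. by apply: tens_ext => u v; rewrite comp_lfunE !tmapE !comp_lfunE. Qed.

Lemma tmap_id (k : fieldType) (U V : vectType k) :
  tmap (\1 : 'End(U))%VF (\1 : 'End(V))%VF = \1%VF.
Proof. by apply: tens_ext => u v; rewrite tmapE !id_lfunE. Qed.

(** * Decompositions with an empty part *)

Section TrivialDecomp.
Variable I : finType.

Lemma void_inj (f : void -> I) : injective f.
Proof. by case. Qed.

Fact decomp0r_cover (i : I) : (i \in codom id) || (i \in codom (of_void I)).
Proof. by apply/orP; left; exact: codom_f id i. Qed.

Fact decomp0r_disjoint : [disjoint codom (@id I) & codom (of_void I)].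
Proof. by rewrite disjoint_sym; apply/pred0P => i; apply/andP => -[/codomP[[]]]. Qed.

Definition decomp0r : decomp I I void :=
  Decomp (@inj_id I) (@void_inj (of_void I)) decomp0r_cover decomp0r_disjoint.

Fact decomp0l_cover (i : I) : (i \in codom (of_void I)) || (i \in codom id).
Proof. by apply/orP; right; exact: codom_f id i. Qed.

Fact decomp0l_disjoint : [disjoint codom (of_void I) & codom (@id I)].
Proof. by apply/pred0P => i; apply/andP => -[/codomP[[]]]. Qed.

Definition decomp0l : decomp I void I :=
  Decomp (@void_inj (of_void I)) (@inj_id I) decomp0l_cover decomp0l_disjoint.

End TrivialDecomp.

(** * Connected q-bimonoids *)

Section Connected.
Variables (k : fieldType) (q : k) (h : qbimonoid q).
Hypothesis h_conn : connected h.

Local Notation mu := (mu (qb_monoid h)).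
Local Notation Delta := (Delta (qb_comonoid h)).
Local Notation iota0 := (iota0 (qb_monoid h)).
Local Notation eps0 := (eps0 (qb_comonoid h)).
Local Notation unit0 := (iota0 (1 : k^o)).

Lemma iota0_eps0 : (iota0 \o eps0 = \1)%VF.
Proof.
by apply: comp_lfun_id_sym (eps0_iota0 h); rewrite dim_ground h_conn.
Qed.

(** Counitality says that [G = (id (x) eps) Delta] is a section of the
    isomorphism [h[I] (x) k -> h[I]], hence its inverse, and [iota] undoes
    [eps] because [h] is connected. *)
Lemma Delta_unitr (I : finType) (x : h I) :
  Delta (decomp0r I) x = tpure x unit0.
Proof.
have counit := @Delta_counitr k h (qb_comonoid h) I (decomp0r I) (fun=> erefl).
set G := (tmap \1 eps0 \o Delta (decomp0r I))%VF in counit.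
have Gtunitr : (G \o tunitr (h I) = \1)%VF.
  by apply: comp_lfun_id_sym counit; rewrite dim_tens dim_ground muln1.
have Gx : G x = tpure x (1 : k^o).
  by rewrite -[x in LHS]scale1r -(tunitrE 1 x) -comp_lfunE Gtunitr id_lfunE.
have -> : Delta (decomp0r I) x = tmap \1%VF iota0 (G x).
  by rewrite !comp_lfunE -(comp_lfunE (tmap _ _)) tmap_comp comp_lfun1l
    iota0_eps0 tmap_id id_lfunE.
by rewrite Gx tmapE id_lfunE.
Qed.

Lemma Delta_unitl (I : finType) (x : h I) :
  Delta (decomp0l I) x = tpure unit0 x.
Proof.
have counit := @Delta_counitl k h (qb_comonoid h) I (decomp0l I) (fun=> erefl).
set G := (tmap eps0 \1 \o Delta (decomp0l I))%VF in counit.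
have Gtunitl : (G \o tunitl (h I) = \1)%VF.
  by apply: comp_lfun_id_sym counit; rewrite dim_tens dim_ground mul1n.
have Gx : G x = tpure (1 : k^o) x.
  by rewrite -[x in LHS]scale1r -(tunitlE 1 x) -comp_lfunE Gtunitl id_lfunE.
have -> : Delta (decomp0l I) x = tmap iota0 \1%VF (G x).
  by rewrite !comp_lfunE -(comp_lfunE (tmap _ _)) tmap_comp comp_lfun1l
    iota0_eps0 tmap_id id_lfunE.
by rewrite Gx tmapE id_lfunE.
Qed.

Lemma mu_unit0r (I : finType) (x : h I) : mu (decomp0r I) (tpure x unit0) = x.
Proof.
rewrite -[x in LHS]id_lfunE -tmapE -comp_lfunE mu_unitr //.
by rewrite tunitrE scale1r.
Qed.

Lemma mu_unit0l (I : finType) (x : h I) : mu (decomp0l I) (tpure unit0 x) = x.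
Proof.
rewrite -[x in LHS]id_lfunE -tmapE -comp_lfunE mu_unitl //.
by rewrite tunitlE scale1r.
Qed.

(** The compatibility axiom with [S' = S] and [T' = T]: here [B] and [C] are
    empty, so it only involves products and coproducts with an empty part. *)
Lemma Delta_mu_same (I S T : finType) (d : decomp I S T) :
  (Delta d \o mu d = \1)%VF.
Proof.
have d4 : decomp4 d d (decomp0r S) (decomp0l T) (decomp0r S) (decomp0l T).
  by split=> // [[]|[]].
apply: tens_ext => x y; rewrite (Delta_mu h d4) id_lfunE !comp_lfunE tmapE.
rewrite Delta_unitr Delta_unitl tswapE card_void mul0n expr0 scale1r tmapE.
by rewrite mu_unit0r mu_unit0l.
Qed.

(** By compatibility the composite factors through
    [(h[A] (x) h[B]) (x) (h[C] (x) h[D])], whose dimension is 0. *)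
Lemma Delta_mu_crossing (I S T S' T' A B C D : finType)
    (dI : decomp I S T) (dI' : decomp I S' T')
    (dS : decomp S A B) (dT : decomp T C D)
    (dS' : decomp S' A C) (dT' : decomp T' B D) :
  decomp4 dI dI' dS dT dS' dT' -> \dim {: h A} = 0%N ->
  (Delta dI' \o mu dI = 0)%VF.
Proof.
move=> d4 hA0; rewrite (Delta_mu h d4).
have -> : tmap (Delta dS) (Delta dT) = 0.
  by apply: dim0_lfun; rewrite !dim_tens hA0 !mul0n.
by rewrite !comp_lfun0r.
Qed.

(** The dimension of [h[I]] makes [mu_{S,T}] invertible, so the vanishing of
    [Delta_{S',T'} mu_{S,T}] passes to [Delta_{S',T'}], which has the right
    inverse [mu_{S',T'}]. *)
Lemma dim_crossing (I S T S' T' A B C D : finType)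
    (dI : decomp I S T) (dI' : decomp I S' T')
    (dS : decomp S A B) (dT : decomp T C D)
    (dS' : decomp S' A C) (dT' : decomp T' B D) :
  decomp4 dI dI' dS dT dS' dT' -> \dim {: h A} = 0%N ->
  \dim {: h I} = (\dim {: h S} * \dim {: h T})%N ->
  (\dim {: h S'} * \dim {: h T'})%N = 0%N.
Proof.
move=> d4 hA0 hI.
have muDelta : (mu dI \o Delta dI = \1)%VF.
  by apply: comp_lfun_id_sym (Delta_mu_same dI); rewrite dim_tens.
have Delta0 : Delta dI' = 0.
  rewrite -[LHS]comp_lfun1r -muDelta comp_lfunA.
  by rewrite (Delta_mu_crossing d4 hA0) comp_lfun0l.
rewrite -dim_tens; apply/eqP; rewrite dimv_eq0 -subv0.
apply/subvP=> t _; rewrite memv0; apply/eqP.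
by rewrite -[t]id_lfunE -(Delta_mu_same dI') Delta0 comp_lfun0l zero_lfunE.
Qed.

End Connected.

(** * Two crossing decompositions of a set of four elements *)

Section OrdDecomp.
Variables m n : nat.

Fact ord_decomp_cover (i : 'I_(m + n)) :
  (i \in codom (@lshift m n)) || (i \in codom (@rshift m n)).
Proof. by case: (split_ordP i) => j ->; rewrite codom_f ?orbT. Qed.

Fact ord_decomp_disjoint :
  [disjoint codom (@lshift m n) & codom (@rshift m n)].
Proof.
apply/pred0P => i; apply/andP => -[/codomP[j ->] /codomP[l /eqP]].
by rewrite eq_lrshift.
Qed.

Definition ord_decomp : decomp 'I_(m + n) 'I_m 'I_n :=
  Decomp (@lshift_inj m n) (@rshift_inj m n) ord_decomp_cover
    ord_decomp_disjoint.

End OrdDecomp.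

Section PermDecomp.
Variables (I S T : finType) (d : decomp I S T) (s : {perm I}).

Fact perm_decomp_cover (i : I) :
  (i \in codom (s \o incl d)) || (i \in codom (s \o incr d)).
Proof.
rewrite -[i](permKV s).
by case/orP: (inc_cover d (s^-1%g i)) => /codomP[j ->];
  rewrite (codom_f (s \o _)) ?orbT.
Qed.

Fact perm_decomp_disjoint :
  [disjoint codom (s \o incl d) & codom (s \o incr d)].
Proof.
apply/pred0P => i; apply/andP => -[/codomP[j ->] /codomP[l /perm_inj e]].
have := disjointFr (inc_disjoint d) (codom_f _ j).
by rewrite e codom_f.
Qed.

Definition perm_decomp : decomp I S T :=
  Decomp (inj_comp (@perm_inj _ s) (@incl_inj _ _ _ d))
    (inj_comp (@perm_inj _ s) (@incr_inj _ _ _ d))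
    perm_decomp_cover perm_decomp_disjoint.

End PermDecomp.

(** Exchanges 1 and 2 in [{0,1,2,3}], and so turns the decomposition
    [{0,1} + {2,3}] into [{0,2} + {1,3}]. *)
Definition swap12 : {perm 'I_(2 + 2)} :=
  tperm (lshift 2 ord_max) (rshift 2 ord0).

Lemma decomp4_2x2 :
  decomp4 (ord_decomp 2 2) (perm_decomp (ord_decomp 2 2) swap12)
    (ord_decomp 1 1) (ord_decomp 1 1) (ord_decomp 1 1) (ord_decomp 1 1).
Proof.
by split=> i; rewrite ord1 /= permE /=; apply: val_inj.
Qed.

(** * Generating function *)

(** The hypothesis says [1 / a = 1 - x^2], so [a_0 = 1], [a_1 = 0] and
    [a_(n+2) = a_n], by comparing coefficients in [a * (1 / a) = 1]. *)
Lemma ps_inv_1subX2 (F : fieldType) (a : nat -> F) :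
    (forall n, ps_inv a n = (n == 0)%N%:R - (n == 2)%N%:R) ->
  [/\ a 1%N = 0, a 2%N = 1 & a 4%N = 1].
Proof.
move=> g.
have a0 : a 0%N = 1.
  (* The constant term is read off the recursion, as [ps_mulV] needs it to be
     nonzero. *)
  have := g 0%N; rewrite /ps_inv /= big_ord0 !subr0 mul1r => e.
  by rewrite -[LHS]invrK e invr1.
have inv n : \sum_(i < n.+1) a i * ps_inv a (n - i)%N = (n == 0)%N%:R.
  by apply: (@ps_mulV _ a); rewrite a0 oner_eq0.
have a1 : a 1%N = 0.
  have := inv 1%N; rewrite !big_ord_recr big_ord0 /= !g /=.
  by rewrite !(subr0, mulr0, mulr1, add0r).
have a2 : a 2%N = 1.
  have := inv 2%N; rewrite !big_ord_recr big_ord0 /= !g /=.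
  rewrite !(subr0, sub0r, mulr0, mulr1, add0r, addr0, mulrN, a0).
  by move/eqP; rewrite addrC subr_eq0 => /eqP.
split=> //; have := inv 4%N; rewrite !big_ord_recr big_ord0 /= !g /=.
rewrite !(subr0, sub0r, mulr0, mulr1, add0r, addr0, mulrN, a0, a2).
by move/eqP; rewrite addrC subr_eq0 => /eqP.
Qed.

Theorem proposition4p9 (k : fieldType) (b : nat -> rat)
    (b2 : b 2%N = 1) (bn : forall n : nat, (1 <= n)%N -> n <> 2%N -> b n = 0)
    (q : k) :
  ~ exists h : qbimonoid q,
      connected h /\
      forall n : nat,
        ps_sub (ps_one rat) (ps_inv (ogf h)) n = if (1 <= n)%N then b n else 0.
Proof.
case=> h [h_conn gf].
have inv n : ps_inv (ogf h) n = (n == 0)%N%:R - (n == 2)%N%:R.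
  have e : ps_inv (ogf h) n = (n == 0)%N%:R - (if (0 < n)%N then b n else 0).
    by rewrite -gf /ps_sub subKr.
  rewrite e; case: n {e} => [|n] //=.
  by have [->|/eqP n2] := eqVneq n.+1 2; rewrite ?b2 // bn.
have [dim1 dim2 dim4] := ps_inv_1subX2 inv.
have dimE n (m : nat) : ogf h n = m%:R -> \dim {: h 'I_n} = m.
  by move/eqP; rewrite eqr_nat => /eqP.
have {}dim1 := dimE 1 0 dim1; have {}dim2 := dimE 2 1 dim2.
have {}dim4 := dimE 4 1 dim4.
have := dim_crossing h_conn decomp4_2x2 dim1.
by rewrite /addn /= dim2 dim4 => /(_ erefl).
Qed.
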